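(* FIFO is a $(1+\gamma/\gamma_0)$-approximation algorithm for C-WGP, where $\gamma=d_I+2$ and $\gamma_0=\lfloor (d_I+1)/2\rfloor$: on every instance, the maximum completion time $\max_j C_j$ of the FIFO schedule is at most $(1+\gamma/\gamma_0)$ times the minimum possible maximum completion time over all feasible schedules.
   Context: The Wireless Gathering Problem (WGP). An instance consists of a finite connected undirected graph $G=(V,E)$, a sink node $s\in V$, a positive integer $d_I$ (interference radius), and a set of packets $J=\{1,\dots,m\}$; each packet $j$ has an origin $o_j\in V$ and a release date $r_j\in\mathbb{Z}_{\ge 0}$. Time is divided into rounds $0,1,2,\dots$. In a round, if $u,v$ are adjacent, $u$ may send a packet it currently holds to $v$; this is a call $(u,v)$. Let $d(u,v)$ be the shortest-path distance in $G$. Two calls $(u,v)$ and $(u',v')$ in the same round interfere if $d(u',v)\le d_I$ or $d(u,v')\le d_I$; otherwise they are compatible. A feasible schedule specifies, for each round, a set of pairwise compatible calls, each moving one packet, such that every packet exists in a unique copy, packet $j$ is not sent before round $r_j$, and every packet eventually reaches $s$. If $x_j^t$ is the node holding $j$ at time $t$ (a packet sent in round $t$ is at its new node at time $t+1$), the completion time is $C_j=\min\{t: x_j^t=s\}$. C-WGP is the problem of finding a feasible schedule minimizing $\max_j C_j$. Priority Greedy: each packet is given a unique priority; in every round, the available packets (released and not yet at $s$) are considered in order of decreasing priority, and each is sent from its current node to a neighbor one step closer to $s$ (i.e. along a shortest path to $s$), provided this call causes no interference with the calls already chosen in this round for higher-priority packets; otherwise it is not sent in this round. FIFO is the Priority Greedy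 algorithm in which packets with earlier release dates have higher priority (ties broken arbitrarily). *)

(* Defs.v *)
From mathcomp Require Import all_boot.

Set Implicit Arguments.
Unset Strict Implicit.
Unset Printing Implicit Defensive.

(* Shortest-path distance; shortest paths have fewer than #|V| edges, so the
   default value #|V| is only returned when v is unreachable from u. *)
Definition dist (V : finType) (e : rel V) (u v : V) : nat :=
  \big[minn/#|V|]_(n < #|V| |
    [exists p : n.-tuple V, path e u p && (last u p == v)]) n.

Record wgp := WGP {
  node : finType;
  adj : rel node;
  adj_sym : symmetric adj;
  adj_irr : irreflexive adj;
  adj_conn : forall u v : node, connect adj u v;
  sink : node;
  dI : nat;
  dI_gt0 : 0 < dI;
  npackets : nat;
  origin : 'I_npackets -> node;
  release : 'I_npackets -> nat }.

Definition interfere (I : wgp) (c c' : node I * node I) : bool :=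
  (dist (@adj I) c'.1 c.2 <= dI I) || (dist (@adj I) c.1 c'.2 <= dI I).

(* [S t j = Some v]: in round t, packet j is sent from the node holding it
   to v; [S t j = None]: packet j is not sent in round t. *)
Definition schedule (I : wgp) := nat -> 'I_(npackets I) -> option (node I).

(* The node x_j^t holding packet j at time t. *)
Fixpoint pos (I : wgp) (S : schedule I) (t : nat) (j : 'I_(npackets I)) :
    node I :=
  if t is t'.+1 then odflt (pos S t' j) (S t' j) else origin j.

(* Compatibility is required between the calls of any two distinct packets;
   since 0 < dI, a call interferes with itself, so this also forces each call
   to move a single packet. *)
Record feasible (I : wgp) (S : schedule I) : Prop := Feasible {
  sent_released : forall t j v, S t j = Some v -> release j <= t;
  sent_adj : forall t j v, S t j = Some v -> adj (pos S t j) v;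
  sent_compatible : forall t j k v w, j != k ->
    S t j = Some v -> S t k = Some w ->
    ~~ interfere (pos S t j, v) (pos S t k, w);
  delivered : forall j, exists t, pos S t j == sink I }.

Definition completion (I : wgp) (S : schedule I) (hS : feasible S)
    (j : 'I_(npackets I)) : nat :=
  ex_minn (delivered hS j).

Definition Cmax (I : wgp) (S : schedule I) (hS : feasible S) : nat :=
  \max_(j < npackets I) completion hS j.

Definition is_opt (I : wgp) (opt : nat) : Prop :=
  (exists (S : schedule I) (hS : feasible S), Cmax hS = opt) /\
  (forall (S : schedule I) (hS : feasible S), opt <= Cmax hS).

Definition available (I : wgp) (S : schedule I) (t : nat)
    (j : 'I_(npackets I)) : bool :=
  (release j <= t) && (pos S t j != sink I).

Definition closer (I : wgp) (u v : node I) : bool :=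
  adj u v && (dist (@adj I) u (sink I) == (dist (@adj I) v (sink I)).+1).

(* The call (pos S t j, v) interferes with a call chosen in round t for a
   packet of higher priority. *)
Definition blocked (I : wgp) (prio : 'I_(npackets I) -> nat) (S : schedule I)
    (t : nat) (j : 'I_(npackets I)) (v : node I) : bool :=
  [exists k, (prio j < prio k) &&
    (if S t k is Some w then interfere (pos S t k, w) (pos S t j, v)
     else false)].

(* [S] is an output of Priority Greedy for [prio] (larger value = higher
   priority). When several neighbours are closer to the sink, the choice of v
   is unrestricted, and may vary with the round and the packet. *)
Definition priority_greedy (I : wgp) (prio : 'I_(npackets I) -> nat)
    (S : schedule I) : Prop :=
  forall t j,
    if available S t j then
      exists2 v, closer (pos S t j) v &
        S t j = if blocked prio S t j v then None else Some v
    else S t j = None.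

Definition fifo_priority (I : wgp) (prio : 'I_(npackets I) -> nat) : Prop :=
  injective prio /\
  (forall j k, release j < release k -> prio k < prio j).

Definition gamma (I : wgp) : nat := dI I + 2.

Definition gamma0 (I : wgp) : nat := (dI I + 1) %/ 2.

(* Main.v *)
(** Write [delta i] for the distance of the origin of packet [i] to the sink.
    If Priority Greedy holds packet [j] back in round [t], then a packet [k] of
    higher priority moves within distance [dI + 1] of [j], so that the delay
    of [j] is charged to [k]: [j] arrives at most [minn gamma (delta j)] rounds
    after [k]. Following the blockers, [j] arrives no later than [L] plus the
    sum of the [minn gamma (delta i)], where [L] is the maximum of
    [release k + delta k] over the packets that do not start at the sink.
    Conversely every schedule needs at least [L] rounds, and at least
    [\sum_i minn (delta i) gamma0] rounds: two calls towards the sink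
    from nodes within distance [gamma0] of it always interfere, and each packet
    needs [minn (delta i) gamma0] such calls. *)
Require Import Defs.
From mathcomp Require Import all_boot all_order all_algebra.
From mathcomp Require Import zify.
From Stdlib Require Import Classical.

Set Implicit Arguments.
Unset Strict Implicit.
Unset Printing Implicit Defensive.

Import Order.TTheory GRing.Theory Num.Theory.

(** * Shortest-path distance in a finite connected graph *)

Section Distance.
Variables (V : finType) (e : rel V).
Implicit Types u v w : V.

Lemma dist_path u p : path e u p -> dist e u (last u p) <= size p.
Proof.
move=> ep; have [lt_p|] := ltnP (size p) #|V|.
  apply: (@bigmin_le_cond _ _ 'I_#|V| #|V| (Ordinal lt_p) _ val) => /=.
  by apply/existsP; exists (in_tuple p); rewrite ep eqxx.
(* A walk with at least [#|V|] edges is covered by the default value, which [dist] never exceeds. *)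
by apply: leq_trans; apply: (@bigmin_le_id _ _ 'I_#|V| _ #|V| _ val).
Qed.

Hypothesis e_conn : forall u v, connect e u v.

Lemma dist_pathP u v :
  exists p, [/\ path e u p, last u p = v & size p = dist e u v].
Proof.
have /connectP [p0 ep0 ->] := e_conn u v.
have [p ep up _] := shortenP ep0.
have lt_p : size p < #|V|
  by have := max_card (mem (u :: p)); rewrite (card_uniqP up).
have [||n /existsP [q /andP [eq_q /eqP lq]] dn] := @eq_bigmin _ _ 'I_#|V| #|V|
    (Ordinal lt_p) (fun n : 'I_#|V| =>
      [exists q : n.-tuple V, path e u q && (last u q == last u p)]) val.
- by apply/existsP; exists (in_tuple p); rewrite ep eqxx.
- by move=> n _; apply/ltnW/(ltn_ord n).
by exists q; split; rewrite ?size_tuple -?dn.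
Qed.

Lemma dist_refl u : dist e u u = 0.
Proof. by apply/eqP; rewrite -leqn0; apply: (dist_path (p := [::])). Qed.

Lemma dist_eq0 u v : (dist e u v == 0) = (u == v).
Proof.
apply/eqP/eqP => [|->]; last exact: dist_refl.
by have [p [_ <- <-]] := dist_pathP u v => /size0nil ->.
Qed.

Lemma dist_triangle u v w : dist e u w <= dist e u v + dist e v w.
Proof.
have [p [ep lp <-]] := dist_pathP u v; have [q [eq_q lq <-]] := dist_pathP v w.
by rewrite -size_cat -lq -lp -last_cat dist_path // cat_path ep lp.
Qed.

Lemma dist_edge u v : e u v -> dist e u v <= 1.
Proof. by move=> euv; apply: (dist_path (p := [:: v])); rewrite /= euv. Qed.

Lemma dist_step u v w : e u v -> dist e u w <= (dist e v w).+1.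
Proof.
move=> /dist_edge uv; apply: leq_trans (dist_triangle u v w) _.
by rewrite -add1n leq_add2r.
Qed.

Hypothesis e_sym : symmetric e.

Lemma dist_sym u v : dist e u v = dist e v u.
Proof.
wlog suff: u v / dist e v u <= dist e u v.
  by move=> le; apply/eqP; rewrite eqn_leq !le.
have [p [ep lp <-]] := dist_pathP u v.
have := @dist_path v (rev (belast u p)).
rewrite size_rev size_belast -lp rev_path.
rewrite (eq_path (e' := e)) => [/(_ ep)|x y]; last exact: e_sym.
by case: p {ep lp} => [|w p] //=; rewrite rev_cons last_rcons.
Qed.

Lemma exists_closer u v : u != v ->
  exists w, e u w && (dist e u v == (dist e w v).+1).
Proof.
have [[|w p] [/= + lp sp]] := dist_pathP u v; first by rewrite lp eqxx.
case/andP=> euw ewp _; exists w; rewrite euw eqn_leq dist_step //.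
by rewrite -sp /= ltnS -lp dist_path.
Qed.

End Distance.

Section Gathering.
Variable I : wgp.
Implicit Types (S : schedule I) (j k : 'I_(npackets I)) (t : nat).
Implicit Types u v w : node I.

Local Notation dst := (dist (@adj I)).
Local Notation depth u := (dst u (sink I)).
Local Notation delta j := (depth (origin j)).

Lemma depth_triangle u v : depth u <= dst u v + depth v.
Proof. exact/dist_triangle/adj_conn. Qed.

Lemma depth_eq0 u : (depth u == 0) = (u == sink I).
Proof. exact/dist_eq0/adj_conn. Qed.

Lemma interfere_sym (c c' : node I * node I) : interfere c c' = interfere c' c.
Proof. by rewrite /interfere orbC. Qed.

(** * Lower bounds on the makespan of a feasible schedule *)

Section Feasible.
Variables (S : schedule I) (hS : feasible S).

Lemma depth_pos_le j t : depth (pos S t j) <= (depth (pos S t.+1 j)).+1.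
Proof.
rewrite /=; case E: (S t j) => [v|] //=.
by apply: dist_step (sent_adj hS E); apply: adj_conn.
Qed.

Lemma depth_origin_le j t : delta j <= depth (pos S t j) + (t - release j).
Proof.
elim: t => [|t IH]; first by rewrite leq_addr.
case: (leqP (release j) t) => [le_rt|lt_tr].
  by have := depth_pos_le j t; lia.
suff -> : pos S t.+1 j = pos S t j by lia.
rewrite /=; case E: (S t j) => [v|] //.
by have := sent_released hS E; lia.
Qed.

Lemma pos_completion j : pos S (completion hS j) j = sink I.
Proof. by rewrite /completion; case: ex_minnP => t /eqP. Qed.

Lemma completion_le j t : pos S t j = sink I -> completion hS j <= t.
Proof.
by move=> /eqP pt; rewrite /completion; case: ex_minnP => ? _; apply.
Qed.

Lemma completion_le_Cmax j : completion hS j <= Cmax hS.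
Proof. exact: leq_bigmax. Qed.

Lemma release_delta_le_completion j :
  origin j != sink I -> release j + delta j <= completion hS j.
Proof.
(* A positive [delta j] excludes completion before the release date, where the truncated subtraction
   gives 0. *)
rewrite -depth_eq0; have := depth_origin_le j (completion hS j).
rewrite pos_completion dist_refl; lia.
Qed.

Definition core_call t j : bool :=
  depth (pos S t.+1 j) < depth (pos S t j) <= gamma0 I.

(** Through the sink, the sender of one call is within [gamma0 + (gamma0 - 1) <= dI] of the receiver
    of the other. *)
Lemma core_call_inj t j k : core_call t j -> core_call t k -> j = k.
Proof.
rewrite /core_call /=; case Ej: (S t j) => [v|] /=; last by rewrite ltnn.
case Ek: (S t k) => [w|] /=; last by rewrite ltnn.
move=> cj ck; apply/eqP/negPn/negP => /(sent_compatible hS)/(_ Ej Ek)/negP.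
apply; apply/orP; left => /=.
have := dist_triangle (@adj_conn I) (pos S t k) (sink I) v.
rewrite (dist_sym (@adj_conn I) (@adj_sym I) (sink I) v).
move: cj ck; rewrite /gamma0; lia.
Qed.

Lemma sum_core_call_le1 t : \sum_j core_call t j <= 1.
Proof.
rewrite -big_mkcond /= sum1_card; apply/card_le1_eqP => j k cj ck.
exact: (@core_call_inj t).
Qed.

(** The potential [minn depth gamma0] drops by at most one per round, and only in a core call. *)
Lemma core_calls_of_packet j t :
  minn (delta j) (gamma0 I) <=
  minn (depth (pos S t j)) (gamma0 I) + \sum_(r < t) core_call r j.
Proof.
elim: t => [|t IH]; first by rewrite big_ord0 addn0.
rewrite big_ord_recr /=; have := depth_pos_le j t.
move: IH; rewrite /core_call /=; lia.
Qed.

(** Double counting of the core calls before [Cmax hS], by packet and by round. *)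
Lemma sum_delta_le_Cmax : \sum_j minn (delta j) (gamma0 I) <= Cmax hS.
Proof.
apply: (@leq_trans (\sum_j \sum_(r < Cmax hS) core_call r j)).
  apply: leq_sum => j _; have le_C := completion_le_Cmax j.
  apply: leq_trans (core_calls_of_packet j (completion hS j)) _.
  rewrite pos_completion dist_refl ?min0n ?add0n.
  by rewrite -!(big_mkord xpredT (fun r => core_call r j : nat))
             [leqRHS](big_cat_nat (leq0n (completion hS j))) //= leq_addr.
rewrite exchange_big /= -[leqRHS]card_ord -sum1_card.
by apply: leq_sum => r _; apply: sum_core_call_le1.
Qed.

End Feasible.

(** * One round of Priority Greedy *)

Section Greedy.
Variables (prio : 'I_(npackets I) -> nat) (S : schedule I).
Hypothesis greedyS : priority_greedy prio S.

Lemma greedy_sent t j v : S t j = Some v ->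
  [/\ available S t j, closer (pos S t j) v & ~~ blocked prio S t j v].
Proof.
have := greedyS t j; case: ifP => [_ [w cw ->]|_ -> //].
by case: ifP => // /negbT nb [<-].
Qed.

Lemma greedy_held t j : available S t j -> S t j = None ->
  exists k, [/\ prio j < prio k, S t k != None &
                depth (pos S t j) <= depth (pos S t k) + (dI I).+1].
Proof.
move=> av Sn; have := greedyS t j; rewrite av Sn => -[v cv].
case: ifP => // /existsP [k /andP [lt_jk]].
case Ek: (S t k) => [w|] // itf _; exists k; split=> //; first by rewrite Ek.
have [_ /andP [_ /eqP dk] _] := greedy_sent Ek.
have {cv} /andP [_ /eqP dj] := cv.
(* The second case is the extremal one: the receiver [v] is within [dI] of the blocker, and [j] is
   one step further from the sink than [v]. *)
case/orP: itf => /= itf.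
  have := depth_triangle (pos S t j) w; lia.
have := depth_triangle v (pos S t k).
rewrite (dist_sym (@adj_conn I) (@adj_sym I) v (pos S t k)); lia.
Qed.

(** Delivery is a hypothesis here; it follows later from the arrival bound, whose proof does not
    presuppose feasibility. *)
Lemma greedy_feasible_delivered (inj_prio : injective prio) :
  (forall j, exists t, pos S t j == sink I) -> feasible S.
Proof.
move=> del; split=> //.
- by move=> t j v /greedy_sent [/andP []].
- by move=> t j v /greedy_sent [_ /andP []].
move=> t j k v w ne_jk Ej Ek.
wlog lt_jk : j k v w ne_jk Ej Ek / prio j < prio k.
  move=> hw; case: (ltngtP (prio j) (prio k)) => [|lt_kj|/inj_prio].
  - exact: hw.
  - by rewrite interfere_sym; apply: hw lt_kj => //; rewrite eq_sym.
  - by move/eqP; rewrite (negPf ne_jk).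
have [_ _] := greedy_sent Ej; apply: contra => itf.
by apply/existsP; exists k; rewrite lt_jk Ek interfere_sym.
Qed.

Lemma greedy_pos_sink t j : pos S t j = sink I -> pos S t.+1 j = sink I.
Proof.
move=> ps; have := greedyS t j; rewrite /available ps eqxx andbF /= => ->.
by rewrite /= ps.
Qed.

Lemma greedy_depth_sent t j :
  S t j != None -> depth (pos S t j) = (depth (pos S t.+1 j)).+1.
Proof.
rewrite /=; case E: (S t j) => [v|] //= _.
by have [_ /andP [_ /eqP]] := greedy_sent E.
Qed.

Lemma greedy_depth_le_delta t j : depth (pos S t j) <= delta j.
Proof.
elim: t => [|t] //; case: (boolP (S t j == None)) => [/eqP|].
  by move=> /= ->.
by move/greedy_depth_sent; lia.
Qed.

End Greedy.

(** * Arrival times under Priority Greedy, and comparison with any feasible schedule *)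

Definition latest_solo : nat :=
  \max_(k | origin k != sink I) (release k + delta k).

Definition arrival_bound (prio : 'I_(npackets I) -> nat) j : nat :=
  latest_solo + \sum_(i | prio j <= prio i) minn (gamma I) (delta i).

Lemma arrival_bound_higher prio j k : prio j < prio k ->
  arrival_bound prio k + minn (gamma I) (delta j) <= arrival_bound prio j.
Proof.
move=> lt_jk; rewrite -addnA leq_add2l [leqRHS](bigD1 j) //= addnC leq_add2l.
rewrite [leqLHS]big_mkcond [leqRHS]big_mkcond /=; apply: leq_sum => i _.
case: (leqP (prio k)) => // le_ki; rewrite (leq_trans (ltnW lt_jk) le_ki) /=.
by case: eqP le_ki => [->|//]; rewrite leqNgt lt_jk.
Qed.

Definition top_prio (prio : 'I_(npackets I) -> nat) : nat := \max_k prio k.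

Lemma leq_top_prio prio k : prio k <= top_prio prio.
Proof. exact: leq_bigmax. Qed.

(** The left side is the arrival time of [j] if it is never held from time [t] on. It grows only in
    a round that holds [j], and is then bounded through the blocker. The outer induction climbs the
    priorities for all times at once, the inner one follows time. *)
Lemma greedy_progress prio S j t : priority_greedy prio S ->
  pos S t j != sink I ->
  maxn t (release j) + depth (pos S t j) <= arrival_bound prio j.
Proof.
move=> gS; have [n] := ubnP (top_prio prio - prio j).
elim: n j t => // n IHn j t le_jn.
elim: t => [|t IHt] ns.
  rewrite max0n /=; apply: leq_trans (leq_addr _ _).
  exact: (@leq_bigmax_cond _ _ (fun k => release k + delta k)).
have nst : pos S t j != sink I.
  by apply: contraNneq ns => /(greedy_pos_sink gS) ->.
have {IHt} IHt := IHt nst.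
case: (boolP (available S t j)) => [av|nav]; last first.
  (* Before its release [j] stays put, and [maxn] equals [release j] at both times. *)
  have := gS t j; rewrite (negPf nav) /= => ->.
  by move: nav IHt; rewrite /available nst andbT /=; lia.
have le_rt : release j <= t by case/andP: av.
case: (boolP (S t j == None)) => [/eqP Sn|]; last first.
  by move/(greedy_depth_sent gS); lia.
have [k [lt_jk Sk le_d]] := greedy_held gS av Sn.
have := arrival_bound_higher lt_jk.
have nsk : pos S t k != sink I.
  by rewrite -depth_eq0 (greedy_depth_sent gS Sk).
have lt_kn : top_prio prio - prio k < n.
  by have := leq_top_prio prio k; lia.
have := IHn k t lt_kn nsk.
(* [gamma] is the gap [dI + 1] to the blocker plus the lost round. In the alternative [delta j], the
   lost round is absorbed by the depth of [k], which is at least 1. *)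
have := greedy_depth_le_delta gS t j; have := greedy_depth_sent gS Sk.
rewrite /= Sn /gamma /=; lia.
Qed.

Lemma greedy_arrived prio S j : priority_greedy prio S ->
  pos S (arrival_bound prio j) j = sink I.
Proof.
move=> gS; apply/eqP/negPn/negP => ns; have := greedy_progress gS ns.
by move: ns; rewrite -depth_eq0; lia.
Qed.

Lemma greedy_feasible prio S :
  injective prio -> priority_greedy prio S -> feasible S.
Proof.
move=> inj_prio gS; apply: (greedy_feasible_delivered gS inj_prio) => j.
by exists (arrival_bound prio j); rewrite (greedy_arrived j gS).
Qed.

Lemma greedy_Cmax_le prio S (gS : priority_greedy prio S) (hS : feasible S) :
  Cmax hS <= latest_solo + \sum_j minn (gamma I) (delta j).
Proof.
apply/bigmax_leqP => j _.
apply: leq_trans (completion_le hS (greedy_arrived j gS)) _.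
by rewrite leq_add2l big_mkcond leq_sum // => i _; case: ifP.
Qed.

(** A packet that starts at the sink completes at time 0 however late its release, hence its
    exclusion from [latest_solo]. *)
Lemma latest_solo_le_Cmax S (hS : feasible S) : latest_solo <= Cmax hS.
Proof.
apply/bigmax_leqP => j /(release_delta_le_completion hS) le_C.
exact: leq_trans le_C (completion_le_Cmax hS j).
Qed.

(** The ratio [gamma / gamma0] for a single packet, cleared of denominators. *)
Lemma gamma0_min_le d :
  gamma0 I * minn (gamma I) d <= gamma I * minn d (gamma0 I).
Proof.
have le_g : gamma0 I <= gamma I by rewrite /gamma0 /gamma; lia.
case: (leqP d (gamma0 I)) => _; first by rewrite leq_mul // geq_minr.
by rewrite mulnC leq_mul // geq_minl.
Qed.

Lemma greedy_approx prio S S' (gS : priority_greedy prio S) (hS : feasible S)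
    (hS' : feasible S') :
  gamma0 I * Cmax hS <= (gamma0 I + gamma I) * Cmax hS'.
Proof.
apply: leq_trans (leq_mul (leqnn _) (greedy_Cmax_le gS hS)) _.
rewrite mulnDr mulnDl.
apply: leq_add; first by rewrite leq_mul ?latest_solo_le_Cmax.
apply: leq_trans (leq_mul (leqnn _) (sum_delta_le_Cmax hS')).
by rewrite !big_distrr leq_sum // => i _; apply: gamma0_min_le.
Qed.

(** * Construction of a greedy schedule for any priorities *)

Section Existence.
Variable prio : 'I_(npackets I) -> nat.

Definition next_hop u : node I := odflt u [pick v | closer u v].

Lemma next_hop_closer u : u != sink I -> closer u (next_hop u).
Proof.
move=> /(exists_closer (@adj_conn I)) [v cv]; rewrite /next_hop.
by case: pickP => [//|/(_ v)]; rewrite /closer cv.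
Qed.

(* The greedy round [t] from positions [x]; [n] is recursion fuel, sufficient
   as soon as it exceeds the number of priority levels above [j]. *)
Fixpoint greedy_calls (x : 'I_(npackets I) -> node I) t n j : option (node I) :=
  if n is n'.+1 then
    if (release j <= t) && (x j != sink I) then
      if [exists k, (prio j < prio k) &&
           (if greedy_calls x t n' k is Some w
            then interfere (x k, w) (x j, next_hop (x j)) else false)]
      then None else Some (next_hop (x j))
    else None
  else None.

(** Only packets of strictly higher priority are consulted, so the gap to [top_prio] shrinks at each
    level of the recursion. *)
Lemma greedy_calls_fuel x t n m j :
  top_prio prio - prio j < n -> top_prio prio - prio j < m ->
  greedy_calls x t n j = greedy_calls x t m j.
Proof.
elim: n m j => // n IHn [//|m] j le_n le_m /=; case: ifP => // _.
congr (if _ then _ else _); apply: eq_existsb => k.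
case: (ltnP (prio j) (prio k)) => //= lt_jk.
by rewrite (IHn m k) //; have := leq_top_prio prio k; lia.
Qed.

Let round x t j := greedy_calls x t (top_prio prio).+1 j.

Fixpoint greedy_pos t : 'I_(npackets I) -> node I :=
  if t is t'.+1 then
    fun j => odflt (greedy_pos t' j) (round (greedy_pos t') t' j)
  else @origin I.

Definition greedy_schedule : schedule I := fun t j => round (greedy_pos t) t j.

Lemma pos_greedy_schedule t j : pos greedy_schedule t j = greedy_pos t j.
Proof. by elim: t j => //= t IH j; rewrite IH. Qed.

Lemma greedy_scheduleP : priority_greedy prio greedy_schedule.
Proof.
move=> t j; rewrite /available pos_greedy_schedule.
case: ifP => av; rewrite {1}/greedy_schedule /round /= av //.
have /andP [_ ns] := av.
exists (next_hop (greedy_pos t j)); first exact: next_hop_closer.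
congr (if _ then _ else _); apply: eq_existsb => k.
rewrite !pos_greedy_schedule.
case: (ltnP (prio j) (prio k)) => //= lt_jk.
have le_k := leq_top_prio prio k.
(* Unfolding round [t] for [j] spent one unit of fuel; the rest suffices for [k], whose priority is
   positive. *)
by rewrite /greedy_schedule /round -(@greedy_calls_fuel _ _ (top_prio prio)) //; lia.
Qed.

End Existence.

(** * The optimum and the approximation ratio *)

Lemma exists_opt S : feasible S -> exists opt, is_opt I opt.
Proof.
move=> hS; pose P n := exists S (hS : feasible S), Cmax hS = n.
have [n] : exists n, P n by exists (Cmax hS), S, hS.
elim/ltn_ind: n => n IH Pn.
(* Excluded middle gives the least attained makespan by descent. *)
case: (classic (exists2 m, m < n & P m)) => [[m] /IH //|noP].
exists n; split=> // S' hS'; rewrite leqNgt; apply/negP => lt_C.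
by apply: noP; exists (Cmax hS') => //; exists S', hS'.
Qed.

End Gathering.

Local Open Scope ring_scope.

Theorem theorem4p3 (I : wgp) (prio : 'I_(npackets I) -> nat)
    (hprio : fifo_priority prio) :
  exists opt : nat, is_opt I opt /\
    (exists S : schedule I, priority_greedy prio S) /\
    (forall S : schedule I, priority_greedy prio S ->
      exists hS : feasible S,
        (Cmax hS)%:R <= (1 + (gamma I)%:R / (gamma0 I)%:R) * opt%:R :> rat).
Proof.
have [inj_prio _] := hprio.
have gS0 := greedy_scheduleP prio.
have [opt hopt] := exists_opt (greedy_feasible inj_prio gS0).
exists opt; split=> //; split; first by exists (greedy_schedule prio).
move=> S gS; exists (greedy_feasible inj_prio gS).
have [[S' [hS' <-]] _] := hopt.
(* As [dI] is positive, [gamma0] is at least 1, so the quotient is genuine and can be cleared. *)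
have g0 : 0 < (gamma0 I)%:R :> rat.
  by rewrite ltr0n /gamma0; have := dI_gt0 I; lia.
rewrite -(ler_pM2l g0) mulrA mulrDr mulr1 mulrCA divff ?gt_eqF // mulr1.
by rewrite -natrD -!natrM ler_nat; apply: greedy_approx gS _ hS'.
Qed.
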